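(* Consider SCAD or MCP penalized least squares regression, with objective function $$\mathcal Q_n(\boldsymbol\beta)=(2n)^{-1}\|\mathbf y-\mathbf X\boldsymbol\beta\|^2+\sum_{j=1}^pp_\lambda(|\beta_j|),$$ where $p_\lambda$ is the SCAD penalty with parameter $a>2$ or the MCP penalty with parameter $a>1$. Let $\widehat{\boldsymbol\beta}(\lambda)$ be any local minimum of $\mathcal Q_n$ with $\|\widehat{\boldsymbol\beta}(\lambda)\|_0\le qu_n$ for some $u_n>0$, and let $u_n^*=u_n+1$. Assume conditions (A1) and (A2) stated in the context hold, and that the relaxed sparse Riesz condition in an $L_0$-neighborhood of the true model is satisfied for $m=qu_n^*$. If $\lambda=o(d_* )$, then for all $n$ sufficiently large, $$P\Bigl\{\bigl\|\widehat{\boldsymbol\beta}(\lambda)-\widehat{\boldsymbol\beta}^{(o)}\bigr\|\le2\lambda\sqrt{qu_n^*}\,\xi_{\min}^{-1}(qu_n^* )\Bigr\}\ \ge\ 1-2q\exp\bigl[-C_1n(d_*-a\lambda)^2/(2\sigma^2)\bigr]-2(p-q)\exp\bigl[-n\lambda^2/(2\sigma^2)\bigr].$$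
   Context: Model: for each $n$, $\mathbf y=\mathbf X\boldsymbol\beta^*+\boldsymbol\varepsilon$, where $\mathbf X$ is a nonrandom $n\times p$ matrix with columns $\mathbf x_{(j)}$ normalized so that $\mathbf x_{(j)}^T\mathbf x_{(j)}/n=1$, $\boldsymbol\beta^*\in\mathbb R^p$ is the true parameter, $\boldsymbol\varepsilon=(\varepsilon_1,\dots,\varepsilon_n)^T$. The quantities $p$ (which may greatly exceed $n$), $q,\lambda,u_n,d_*,\mathbf X,\boldsymbol\beta^*$ may depend on $n$. $A_0=\{j:\beta_j^*\ne0\}$, $q=|A_0|$, $d_*=\min\{|\beta_j^*|:\beta_j^*\ne0\}$. $\mathbf X_B$ is the submatrix of columns of $\mathbf X$ with index in $B$. $\|\cdot\|$ is the Euclidean norm and $\|\mathbf v\|_0=\#\{j:v_j\neq0\}$. The oracle estimator $\widehat{\boldsymbol\beta}^{(o)}$ has its $A_0$-subvector equal to the least squares estimator from regressing $\mathbf y$ on $\mathbf X_{A_0}$, and all other components $0$. Penalties (on $t\ge0$, determined by their derivatives, with $p_\lambda(0)=0$): SCAD has $\dot p_\lambda(t)=\lambda\bigl\{I(t\le\lambda)+\frac{(a\lambda-t)_+}{(a-1)\lambda}I(t>\lambda)\bigr\}$ with constant $a>2$; MCP has $\dot p_\lambda(t)=a^{-1}(a\lambda-t)_+$ with constant $a>1$. Here $b_+=bI(b>0)$. $\xi_{\min}(m)=\min_{|B|\le m,\ A_0\subseteq B}\lambda_{\min}(n^{-1}\mathbf X_B^T\mathbf X_B)$, with $\lambda_{\min}$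 the smallest eigenvalue. The relaxed sparse Riesz condition (SRC) in an $L_0$-neighborhood of the true model is satisfied for a positive integer $m$ ($2q\le m\le n$) if $\xi_{\min}(m)\ge c_*$ for some constant $0<c_*<\infty$. Conditions: (A1) There is a constant $C_1>0$ with $\lambda_{\min}(n^{-1}\mathbf X_{A_0}^T\mathbf X_{A_0})\ge C_1$. (A2) $\varepsilon_1,\dots,\varepsilon_n$ are i.i.d. mean zero sub-Gaussian with scale factor $0<\sigma<\infty$: $E[\exp(t\varepsilon_i)]\le e^{\sigma^2t^2/2}$ for all $t$. *)

(* Defs.v *)
From HB Require Import structures.
From mathcomp Require Import all_boot all_order all_algebra.
From mathcomp Require Import all_classical all_reals all_analysis.

Set Implicit Arguments.
Unset Strict Implicit.
Unset Printing Implicit Defensive.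

Import Order.TTheory GRing.Theory Num.Theory.
Import numFieldNormedType.Exports.

Local Open Scope classical_set_scope.
Local Open Scope ring_scope.

Definition norm2 (R : realType) (k : nat) (v : 'cV[R]_k) : R :=
  Num.sqrt (\sum_i v i 0 ^+ 2).

Definition supp (R : realType) (p : nat) (b : 'cV[R]_p) : {set 'I_p} :=
  [set j | b j 0 != 0]%SET.

Definition norm0 (R : realType) (p : nat) (b : 'cV[R]_p) : nat := #|supp b|.

(* Meant for nonzero [b], where [inf] is the minimum of a finite nonempty set. *)
Definition min_signal (R : realType) (p : nat) (b : 'cV[R]_p) : R :=
  inf [set `|b j 0| | j in [set j | j \in supp b]].

Definition pos_part (R : realType) (b : R) : R := b * (0 < b)%R%:R.

Variant penalty := SCAD | MCP.

Definition admissible (R : realType) (k : penalty) (a : R) : Prop :=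
  match k with SCAD => 2 < a | MCP => 1 < a end.

Definition pen_deriv (R : realType) (k : penalty) (a l t : R) : R :=
  match k with
  | SCAD => l * ((t <= l)%R%:R
                 + pos_part (a * l - t) / ((a - 1) * l) * (l < t)%R%:R)
  | MCP => a^-1 * pos_part (a * l - t)
  end.

(* The function on [0, +oo[ with value 0 at 0 and derivative [pen_deriv k a l]. *)
Definition pen (R : realType) (k : penalty) (a l t : R) : R :=
  \int[@lebesgue_measure R]_(s in `[0, t]) pen_deriv k a l s.

Definition objective (R : realType) (k : penalty) (a l : R) (n p : nat)
    (X : 'M[R]_(n, p)) (y : 'cV[R]_n) (b : 'cV[R]_p) : R :=
  (2 * n%:R)^-1 * norm2 (y - X *m b) ^+ 2 + \sum_j pen k a l `|b j 0|.

Definition local_minimum (R : realType) (p : nat) (f : 'cV[R]_p -> R)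
    (b : 'cV[R]_p) : Prop :=
  exists2 e : R, 0 < e & forall b', norm2 (b' - b) < e -> f b <= f b'.

Definition cols_in (R : realType) (n p : nat) (X : 'M[R]_(n, p))
    (B : {set 'I_p}) : 'M[R]_(n, #|B|) := colsub (fun i : 'I_#|B| => enum_val i) X.

Definition rows_in (R : realType) (p : nat) (b : 'cV[R]_p)
    (B : {set 'I_p}) : 'cV[R]_#|B| := rowsub (fun i : 'I_#|B| => enum_val i) b.

Definition least_squares (R : realType) (n k : nat) (Z : 'M[R]_(n, k))
    (y : 'cV[R]_n) (g : 'cV[R]_k) : Prop :=
  forall g', norm2 (y - Z *m g) <= norm2 (y - Z *m g').

Definition oracle_estimator (R : realType) (n p : nat) (X : 'M[R]_(n, p))
    (y : 'cV[R]_n) (A : {set 'I_p}) (b : 'cV[R]_p) : Prop :=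
  least_squares (cols_in X A) y (rows_in b A) /\
  (forall j, j \notin A -> b j 0 = 0).

(* [A] is meant to be symmetric of positive size, so that its set of real
   eigenvalues is finite and nonempty and [inf] is its minimum. *)
Definition lambda_min (R : realType) (k : nat) (A : 'M[R]_k) : R :=
  inf [set x | eigenvalue A x].

Definition gram (R : realType) (n p : nat) (X : 'M[R]_(n, p))
    (B : {set 'I_p}) : 'M[R]_#|B| :=
  n%:R^-1 *: ((cols_in X B)^T *m cols_in X B).

(* [inf] is the minimum of a finite set, nonempty when [#|A| <= m]. *)
Definition xi_min (R : realType) (n p : nat) (X : 'M[R]_(n, p))
    (A : {set 'I_p}) (m : nat) : R :=
  inf [set lambda_min (gram X B) |
       B in [set B : {set 'I_p} | (#|B| <= m)%N /\ A \subset B]].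

Definition relaxed_SRC (R : realType) (n p : nat) (X : 'M[R]_(n, p))
    (A : {set 'I_p}) (m : nat) (c : R) : Prop :=
  [/\ (0 < m)%N, (2 * #|A| <= m)%N, (m <= n)%N & c <= xi_min X A m].

Definition mutually_independent d (T : measurableType d) (R : realType)
    (P : probability T R) (n : nat) (e : 'I_n -> {RV P >-> R}) : Prop :=
  forall (J : {set 'I_n}) (E : 'I_n -> set R), (forall i, measurable (E i)) ->
    P (\bigcap_(i in [set i | i \in J]) (e i @^-1` E i)) =
    (\prod_(i in J) P (e i @^-1` E i))%E.

Definition identically_distributed d (T : measurableType d) (R : realType)
    (P : probability T R) (n : nat) (e : 'I_n -> {RV P >-> R}) : Prop :=
  forall (i j : 'I_n) (E : set R), measurable E ->
    distribution P (e i) E = distribution P (e j) E.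

Definition iid_subgaussian d (T : measurableType d) (R : realType)
    (P : probability T R) (n : nat) (e : 'I_n -> {RV P >-> R}) (s : R) : Prop :=
  [/\ mutually_independent e,
      identically_distributed e,
      forall i, ('E_P[e i] = 0)%E
    & forall i (t : R),
        ('E_P[(fun w => expR (t * e i w))] <= (expR (s ^+ 2 * t ^+ 2 / 2))%:E)%E].

Definition response (R : realType) (n p : nat) (X : 'M[R]_(n, p))
    (b : 'cV[R]_p) (e : 'I_n -> R) : 'cV[R]_n := X *m b + \col_i e i.

(* [c <= P S] as an inner probability: [S] need not be known to be measurable.
   For measurable [S] it is the plain inequality. *)
Definition prob_ge d (T : measurableType d) (R : realType)
    (P : probability T R) (S : set T) (c : R) : Prop :=
  exists2 E : set T, measurable E /\ E `<=` S & (c%:E <= P E)%E.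

(* Main.v *)
(* Any local minimum b satisfies |x_j^T (y - X b)| <= n lambda for every j: the
   penalty is lambda-Lipschitz, so this follows by perturbing b along the j-th
   axis. The least squares residual y - X bo is orthogonal to the columns of A0
   and equals M eps, with M the projection on the orthogonal complement of their
   span, so bo satisfies the same bounds as soon as |(M x_j)^T eps| <= n lambda
   for the p - q indices outside A0. Since |M x_j|^2 <= n, a Chernoff bound
   controls the probability of this event. On it, delta = b - bo is supported on
   B = A0 :|: supp b, of size at most q (u + 1), and
     xi |delta|^2 <= |X delta|^2 / n <= 2 lambda |delta|_1
                  <= 2 lambda sqrt |B| |delta|. *)
Require Import Defs.
From HB Require Import structures.
From mathcomp Require Import all_boot all_order all_algebra.
From mathcomp Require Import all_classical all_reals all_analysis.
(* Imported again because [all_analysis] alone leaves the canonical measurable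
   structure on [\bar R] shadowed. *)
From mathcomp Require Import measurable_realfun.
From mathcomp Require Import ring lra.
Set Implicit Arguments.
Unset Strict Implicit.
Unset Printing Implicit Defensive.

Import Order.TTheory GRing.Theory Num.Theory.
Import numFieldNormedType.Exports.
Local Open Scope classical_set_scope.
Local Open Scope ring_scope.

Import HBNNSimple.

(** * Independence and expectations of products *)

(** The last hypothesis is the case of an indicator [f], with [c] in the role of the expectation of
    [Y]. Linearity extends it to simple functions, and monotone convergence along [nnsfun_approx] to
    every nonnegative measurable [f], infinite integrals included. *)
Lemma expectation_mul_comp_ind d (T : measurableType d) (R : realType)
    (P : probability T R) (Y : T -> R) (X : {RV P >-> R}) (c : R) (f : R -> R) :
  measurable_fun setT Y -> (forall w, 0 <= Y w) -> 0 <= c ->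
  measurable_fun setT f -> (forall x, 0 <= f x) ->
  (forall E, measurable E ->
    (\int[P]_w (Y w * \1_E (X w))%:E = c%:E * P (X @^-1` E))%E) ->
  (\int[P]_w (Y w * f (X w))%:E = c%:E * \int[P]_w (f (X w))%:E)%E.
Proof.
move=> mY Y0 c0 mf f0 hind.
have mX : measurable_fun setT X by [].
have mEf : measurable_fun setT (EFin \o f) by exact/measurable_EFinP.
pose g := nnsfun_approx measurableT mEf.
have gnd x : nondecreasing_seq (g ^~ x).
  by move=> m n mn; exact/lefP/nd_nnsfun_approx.
have gf x : (EFin \o g ^~ x) @ \oo --> (f x)%:E.
  by apply: (cvg_nnsfun_approx measurableT mEf) => // y _; rewrite /= lee_fin.
have mgX n : measurable_fun setT (fun w => g n (X w)).
  by apply: measurableT_comp.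
have step n : (\int[P]_w (Y w * g n (X w))%:E = c%:E * \int[P]_w (g n (X w))%:E)%E.
  have fr := fimfunP (g n).
  have mpre r : measurable (g n @^-1` [set r]) by exact: measurable_funPTI.
  have mind r : measurable_fun setT (fun w => \1_(g n @^-1` [set r]) (X w) : R).
    exact: (measurableT_comp (measurable_indic (mpre r)) mX).
  (* Here [r] is any real, possibly negative: the term is still nonnegative because the indicator
     vanishes unless [r] is a value of the nonnegative function [g n]. *)
  have range0 r w : 0 <= r * \1_(g n @^-1` [set r]) (X w) :> R.
    rewrite indicE; case: (boolP (_ \in _)); last by rewrite mulr0.
    by rewrite inE /= => <-; rewrite mulr1.
  have eqg w :
      g n (X w) = \sum_(r \in range (g n)) (r * \1_(g n @^-1` [set r]) (X w)).
    by rewrite [LHS]fimfunE.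
  transitivity (\sum_(r \in range (g n))
      (r%:E * (c%:E * P (X @^-1` (g n @^-1` [set r])))))%E.
    transitivity (\int[P]_w (\sum_(r \in range (g n))
        (Y w * (r * \1_(g n @^-1` [set r]) (X w)))%:E))%E.
      apply: eq_integral => w _.
      by rewrite fsumEFin// eqg mulr_fsumr.
    rewrite ge0_integral_fsum//; last 2 first.
    - move=> r; apply/measurable_EFinP; apply: measurable_funM => //.
      exact: measurable_funM.
    - by move=> r w _; rewrite lee_fin mulr_ge0.
    apply: eq_fsbigr => r; rewrite inE => -[x _ <-].
    rewrite -hind// -ge0_integralZl_EFin//.
    - by apply: eq_integral => w _; rewrite -EFinM mulrCA.
    - by move=> w _; rewrite lee_fin mulr_ge0.
    - by apply/measurable_EFinP; exact: measurable_funM.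
  transitivity (c%:E * \sum_(r \in range (g n))
      (r%:E * P (X @^-1` (g n @^-1` [set r]))))%E.
    rewrite ge0_mule_fsumr; last first.
      move=> r; have [r0|r0] := leP 0 r; first by rewrite mule_ge0.
      rewrite (_ : g n @^-1` [set r] = set0) ?preimage_set0 ?measure0 ?mule0//.
      rewrite -subset0 => x /= gx; move: r0; rewrite -gx.
      by rewrite ltNge fun_ge0.
    by apply: eq_fsbigr => r _; rewrite muleCA.
  congr (_ * _)%E.
  transitivity (\int[P]_w (\sum_(r \in range (g n))
        ((r * \1_(g n @^-1` [set r]) (X w)))%:E))%E.
    rewrite ge0_integral_fsum//; last 2 first.
    - by move=> r; apply/measurable_EFinP; exact: measurable_funM.
    - by move=> r w _; rewrite lee_fin.
    apply: eq_fsbigr => r; rewrite inE => -[x _ <-].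
    rewrite -[X in P X]setIT -(integral_indic P measurableT).
    rewrite -ge0_integralZl_EFin//.
    - apply/measurable_EFinP.
      by apply: measurable_indic; rewrite -[X in measurable X]setTI; apply: mX.
    - by rewrite -[X in measurable X]setTI; apply: mX.
  by apply: eq_integral => w _; rewrite fsumEFin// -eqg.
(* Monotone convergence for real-valued sequences, applied once with the factor [Y] and once without
   it. *)
have mct (u : nat -> T -> R) (v : T -> R) :
    (forall n, measurable_fun setT (u n)) -> (forall n w, 0 <= u n w) ->
    (forall w, nondecreasing_seq (u ^~ w)) ->
    (forall w, (u n w)%:E @[n --> \oo] --> (v w)%:E) ->
    (\int[P]_w (u n w)%:E)%E @[n --> \oo] --> (\int[P]_w (v w)%:E)%E.
  move=> mu u0 und uv.
  have -> : (\int[P]_w (v w)%:E = \int[P]_w limn (fun n => (u n w)%:E))%E.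
    by apply: eq_integral => w _; apply/esym/cvg_lim => //; exact: uv.
  apply: cvg_monotone_convergence => //.
  - by move=> n; apply/measurable_EFinP.
  - by move=> n w _; rewrite lee_fin.
  - by move=> w _ m n mn; rewrite lee_fin und.
have L : (\int[P]_w (Y w * g n (X w))%:E)%E @[n --> \oo] -->
    (\int[P]_w (Y w * f (X w))%:E)%E.
  apply: (mct (fun n w => Y w * g n (X w))).
  - by move=> n; exact: measurable_funM.
  - by move=> n w; rewrite mulr_ge0.
  - by move=> w m n mn; rewrite ler_wpM2l// gnd.
  - move=> w; under eq_fun do rewrite EFinM.
    by rewrite EFinM; apply: cvgeZl => //; exact: gf.
have M : (c%:E * \int[P]_w (g n (X w))%:E)%E @[n --> \oo] -->
    (c%:E * \int[P]_w (f (X w))%:E)%E.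
  apply: cvgeZl => //; apply: (mct (fun n w => g n (X w))) => //.
  by move=> w; exact: gf.
move: M; under eq_fun do rewrite -step.
exact: (cvg_unique _ L).
Qed.

Lemma prod_indic (R : comNzRingType) (T : Type) (I : finType) (F : I -> set T)
    (w : T) :
  \prod_i \1_(F i) w = \1_(\bigcap_i F i) w :> R.
Proof.
rewrite [RHS]indicE; case: (boolP (w \in _)) => [|/negP]; rewrite inE => wF.
  by rewrite big1// => i _; rewrite indicE mem_set//; exact: wF.
have [i wFi] : exists i, ~ F i w by apply/existsNP => wF'; apply: wF => i _.
by rewrite (bigD1 i)//= indicE memNset// mul0r.
Qed.

Lemma expectation_prod d (T : measurableType d) (R : realType)
    (P : probability T R) n (e : 'I_n -> {RV P >-> R}) (h : 'I_n -> R -> R) :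
  mutually_independent e ->
  (forall i, measurable_fun setT (h i)) -> (forall i x, 0 <= h i x) ->
  (forall i, (\int[P]_w (h i (e i w))%:E < +oo)%E) ->
  (\int[P]_w (\prod_i h i (e i w))%:E = \prod_i \int[P]_w (h i (e i w))%:E)%E.
Proof.
move=> ind.
have me i : measurable_fun setT (e i) by [].
(* Starting from indicators, where the claim is the independence of events, the
   factors [h i] with [i] in [J] are generalized one at a time. *)
suff H (J : {set 'I_n}) : forall h : 'I_n -> R -> R,
    (forall i, measurable_fun setT (h i)) -> (forall i x, 0 <= h i x) ->
    (forall i, (\int[P]_w (h i (e i w))%:E < +oo)%E) ->
    (forall i, i \notin J -> exists2 E, measurable E & h i = \1_E) ->
    (\int[P]_w (\prod_i h i (e i w))%:E = \prod_i \int[P]_w (h i (e i w))%:E)%E.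
  by move=> mh h0 hoo; apply: (H [set: 'I_n]%SET) => // i; rewrite inE.
elim: {J}#|J| {-2}J (erefl #|J|) => [|k IH] J Jk {}h mh h0 hoo hJ.
  move/eqP: Jk; rewrite cards_eq0 => /eqP J0.
  have /choice[E hE] : forall i, exists E, measurable E /\ h i = \1_E.
    by move=> i; have [|E mE hE] := hJ i; [rewrite J0 inE|exists E].
  have mpre i : measurable (e i @^-1` E i).
    by rewrite -[X in measurable X]setTI; apply: me => //; have [] := hE i.
  transitivity (\int[P]_w (\1_(\bigcap_i (e i @^-1` E i)) w)%:E)%E.
    apply: eq_integral => w _; rewrite -prod_indic; congr EFin.
    by apply: eq_bigr => i _; have [_ ->] := hE i.
  rewrite integral_indic// ?setIT; last first.
    by apply: fin_bigcap_measurable => // i _; exact: mpre.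
  have -> : \bigcap_i (e i @^-1` E i)
      = \bigcap_(i in [set i | i \in [set: 'I_n]%SET]) (e i @^-1` E i).
    by apply/seteqP; split => w wE i _; apply: wE => //=; rewrite inE.
  apply: etrans (ind [set: 'I_n]%SET E _) _; first by move=> i; have [] := hE i.
  apply: eq_big => [i|i _]; first by rewrite inE.
  rewrite -[X in P X]setIT -(integral_indic P measurableT)//.
  by apply: eq_integral => w _; have [_ ->] := hE i.
have /card_gt0P[j jJ] : (0 < #|J|)%N by rewrite Jk.
have prod0 : (0 <= \prod_(i | i != j) \int[P]_w (h i (e i w))%:E)%E.
  by apply: prode_ge0 => i _; apply: integral_ge0 => w _; rewrite lee_fin.
(* Finiteness of each factor makes this product a real number, so that it can serve as the constant
   [c] of [expectation_mul_comp_ind]. *)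
have prodfin : (\prod_(i | i != j) \int[P]_w (h i (e i w))%:E)%E \is a fin_num.
  apply: prode_fin_num => i _.
  by rewrite ge0_fin_numE//; apply: integral_ge0 => w _; rewrite lee_fin.
rewrite [RHS](bigD1 j)//= muleC.
under eq_integral do rewrite (bigD1 j)//= mulrC.
rewrite -(fineK prodfin); apply: expectation_mul_comp_ind => //.
- under eq_fun do rewrite -big_filter.
  by apply: measurable_prod => i _; exact: measurableT_comp.
- by move=> w; apply: prodr_ge0.
- exact: fine_ge0.
move=> E mE; rewrite fineK//.
(* With the [j]-th factor replaced by an indicator, [IH] applies to [h'] and the smaller set of
   indices; this is the indicator case that [expectation_mul_comp_ind] asks for. *)
pose h' i : R -> R := if i == j then \1_E else h i.
have h'j : h' j = \1_E by rewrite /h' eqxx.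
have h'N i : i != j -> h' i = h i by rewrite /h' => /negbTE ->.
have mpre : measurable (e j @^-1` E).
  by rewrite -[X in measurable X]setTI; apply: me.
have Ej : (\int[P]_w (\1_E (e j w))%:E = P (e j @^-1` E))%E.
  by rewrite -[X in P X]setIT -(integral_indic P measurableT).
have /esym : (\int[P]_w (\prod_i h' i (e i w))%:E
    = \prod_i \int[P]_w (h' i (e i w))%:E)%E.
  apply: (IH (J :\ j)%SET) => [|i|i x|i|i].
  - by move: Jk; rewrite (cardsD1 j) jJ => -[].
  - by rewrite /h'; case: eqP => // _; exact: measurable_indic.
  - by rewrite /h'; case: eqP => // _; rewrite indicE.
  - rewrite /h'; case: eqP => [->|//].
    by rewrite Ej (le_lt_trans (probability_le1 _ mpre)) ?ltry.
  - rewrite !inE negb_and negbK => /orP[/eqP ->|/hJ[F mF hF]]; first by exists E.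
    by rewrite /h'; case: eqP => _; [exists E|exists F].
rewrite (bigD1 j)//= h'j Ej muleC.
under eq_bigr do under eq_integral do rewrite h'N//.
move=> ->; apply: eq_integral => w _; rewrite [in RHS](bigD1 j)//= h'j mulrC.
by congr (_ * _)%:E; apply: eq_bigr => i ij; rewrite h'N.
Qed.

(** * Union bound and sub-Gaussian tails *)

Lemma measure_bigsetU_le d (T : measurableType d) (R : realType)
    (mu : {measure set T -> \bar R}) (I : finType) (J : {set I}) (F : I -> set T) :
  (forall i, measurable (F i)) ->
  (mu (\big[setU/set0]_(i in J) F i) <= \sum_(i in J) mu (F i))%E.
Proof.
move=> mF; rewrite big_mkcond [leRHS]big_mkcond /=.
elim: (index_enum _) => [|i s IH]; first by rewrite !big_nil measure0.
rewrite !big_cons; case: ifP => _; last by rewrite set0U add0e.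
apply: le_trans (measureU2 _ _ _) _ => //; last exact: leeD2l.
by apply: bigsetU_measurable => j _; case: ifP.
Qed.

Section subgaussian_tail.
Context d (T : measurableType d) (R : realType) (P : probability T R) (n : nat).
Variables (e : 'I_n -> {RV P >-> R}) (s : R).
Hypotheses (s0 : 0 < s) (He : iid_subgaussian e s).

Let measurable_lin (v : 'I_n -> R) :
  measurable_fun setT (fun w => \sum_i v i * e i w).
Proof. by apply: measurable_sum => i; exact: measurable_funM. Qed.

(** Chernoff bound: the moment generating function of the sum factors by independence. Since [N]
    only dominates the sum of squares, [v] may vanish, and projected columns can later be handled
    with the common value [N = n]. *)
Lemma subgaussian_tail (v : 'I_n -> R) (N t : R) :
  0 < N -> \sum_i v i ^+ 2 <= N -> 0 < t ->
  (P [set w | (t <= \sum_i v i * e i w)%R]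
   <= (expR (- (t ^+ 2 / (2 * s ^+ 2 * N))))%:E)%E.
Proof.
move=> N0 vN t0; have [ind _ _ mgf] := He.
(* This [r] minimizes the exponent [s ^+ 2 * r ^+ 2 * N / 2 - r * t]. *)
pose r := t / (s ^+ 2 * N).
have s20 : 0 < s ^+ 2 by rewrite exprn_gt0.
have r0 : 0 < r by rewrite divr_gt0// mulr_gt0.
pose S : {RV P >-> R} := mfun_Sub (mem_set (measurable_lin v)).
apply: le_trans (chernoff S t r0) _.
have -> : (expR (- (t ^+ 2 / (2 * s ^+ 2 * N))) =
   expR (s ^+ 2 * r ^+ 2 * N / 2) * expR (- (r * t)))%R.
  rewrite -expRD; congr expR; rewrite /r; field.
  by rewrite !gt_eqF.
rewrite EFinM lee_wpmul2r ?lee_fin ?expR_ge0//.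
have E1 i : (\int[P]_w (expR (r * v i * e i w))%:E
    <= (expR (s ^+ 2 * (r * v i) ^+ 2 / 2))%:E)%E.
  by have := mgf i (r * v i); rewrite unlock.
have -> : ('M_P S r = \int[P]_w (\prod_i expR (r * v i * e i w))%:E)%E.
  rewrite /mmt_gen_fun unlock; apply: eq_integral => w _ /=.
  rewrite -expR_sum; congr (expR _)%:E.
  by rewrite /= mulrC mulr_sumr; apply: eq_bigr => i _; rewrite mulrA.
rewrite (expectation_prod (h := fun i x => expR (r * v i * x))) //.
- apply: le_trans (_ : (\prod_i (expR (s ^+ 2 * (r * v i) ^+ 2 / 2))%:E <= _)%E).
    have I0 i : (0 <= \int[P]_w (expR (r * v i * e i w))%:E)%E.
      by apply: integral_ge0 => w _; rewrite lee_fin expR_ge0.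
    (* Comparing products in [\bar R] requires nonnegative factors, so both inequalities are carried
       through the induction together. *)
    suff /andP[] : ((0 <= \prod_i \int[P]_w (expR (r * v i * e i w))%:E) &&
        (\prod_i \int[P]_w (expR (r * v i * e i w))%:E
         <= \prod_i (expR (s ^+ 2 * (r * v i) ^+ 2 / 2))%:E))%E by [].
    elim/big_ind2 : _ => [|x1 x2 y1 y2 /andP[x0 x12] /andP[y0 y12]|i _].
    - by rewrite lee01 lexx.
    - by rewrite mule_ge0//= lee_pmul.
    - by rewrite I0 E1.
  rewrite prodEFin lee_fin -expR_sum ler_expR.
  rewrite -mulr_suml ler_pM2r ?invr_gt0// -mulr_sumr -mulrA ler_pM2l//.
  under eq_bigr do rewrite exprMn.
  by rewrite -mulr_sumr ler_pM2l ?exprn_gt0.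
- by move=> i; apply: measurableT_comp => //; exact: measurable_funM.
- by move=> i; apply: le_lt_trans (E1 i) (ltry _).
Qed.

Lemma measurable_max_lin p (J : {set 'I_p}) (v : 'I_p -> 'I_n -> R) (t : R) :
  measurable [set w | forall j, j \in J -> `|\sum_i v j i * e i w| <= t].
Proof.
have -> : [set w | forall j, j \in J -> `|\sum_i v j i * e i w| <= t] =
    \bigcap_(j in [set` J]) ((fun w => `|\sum_i v j i * e i w|) @^-1` `]-oo, t]).
  by apply/seteqP; split => w /= H j /= jJ; have := H j jJ; rewrite /= in_itv.
apply: fin_bigcap_measurable => // j _; rewrite -[X in measurable X]setTI.
have mf : measurable_fun setT (fun w => `|\sum_i v j i * e i w|).
  by apply: measurableT_comp => //; exact: measurable_lin.
exact: mf.
Qed.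

(** Union bound over [2 * #|J|] one-sided events: the lower tail for [v j] is the upper tail for its
    opposite. *)
Lemma subgaussian_max_tail p (J : {set 'I_p}) (v : 'I_p -> 'I_n -> R) (N t : R) :
  0 < N -> (forall j, j \in J -> \sum_i v j i ^+ 2 <= N) -> 0 < t ->
  ((1 - 2 * #|J|%:R * expR (- (t ^+ 2 / (2 * s ^+ 2 * N))))%:E <=
   P [set w | (forall j, j \in J -> `|\sum_i v j i * e i w| <= t)%R])%E.
Proof.
move=> N0 vN t0.
pose F j := [set w | (t <= \sum_i v j i * e i w)%R]
  `|` [set w | (t <= \sum_i (- v j i) * e i w)%R].
have mle (u : 'I_n -> R) : measurable [set w | (t <= \sum_i u i * e i w)%R].
  rewrite -[X in measurable X]setTI.
  have -> : [set w | (t <= \sum_i u i * e i w)%R]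
      = (fun w => \sum_i u i * e i w) @^-1` `[t, +oo[.
    by apply/seteqP; split => w /=; rewrite in_itv/= andbT.
  exact: measurable_lin.
have mF j : measurable (F j) by apply: measurableU.
rewrite -[X in P X]setCK probability_setC; last exact/measurableC/measurable_max_lin.
rewrite EFinB leeB//.
apply: le_trans (_ : P (\big[setU/set0]_(j in J) F j) <= _)%E.
  apply: le_measure; rewrite ?inE.
  - exact/measurableC/measurable_max_lin.
  - exact: bigsetU_measurable.
  move=> w /= /existsNP[j /not_implyP[jJ /negP]]; rewrite -ltNge => tw.
  rewrite -bigcup_pred; exists j => //=.
  move: tw; rewrite ltr_normr => /orP[|] /ltW tw; [by left|right].
  rewrite /= (eq_bigr (fun i => - (v j i * e i w))) ?sumrN// => i _.
  by rewrite mulNr.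
apply: le_trans (measure_bigsetU_le _ _ mF) _.
apply: le_trans (_ : \sum_(j in J) (2 * expR (- (t ^+ 2 / (2 * s ^+ 2 * N))))%:E <= _)%E.
  apply: lee_sum => j jJ; rewrite mulrDl mul1r EFinD.
  apply: le_trans (measureU2 _ _ _) _ => //.
  apply: leeD; apply: subgaussian_tail => //; first exact: vN.
  by under eq_bigr do rewrite sqrrN; exact: vN.
rewrite sumEFin lee_fin sumr_const le_eqVlt; apply/orP; left; apply/eqP.
ring.
Qed.

End subgaussian_tail.

(** * Perturbation criterion and Euclidean norm *)

(** Dividing by [2 * |h|] and letting [h] tend to 0 with the sign of [s] gives the bound. This
    replaces differentiation in every optimality argument: [l = 0] handles smooth objectives, and
    [l > 0] absorbs the kink of the penalty. *)
Lemma ler_norm_quadratic (R : realType) (s N l e : R) :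
  0 <= N -> 0 < e ->
  (forall h, `|h| < e -> 2 * h * s <= h ^+ 2 * N + 2 * l * `|h|) -> `|s| <= l.
Proof.
move=> N0 e0 H; rewrite leNgt; apply/negP => ls.
have d0 : 0 < `|s| - l by rewrite subr_gt0.
(* A step below [e] with [t * N < |s| - l]; the denominator is [N + 1] because [N] may be 0. *)
pose t := Num.min (e / 2) ((`|s| - l) / (N + 1)).
have t0 : 0 < t by rewrite lt_min; apply/andP; split; apply: divr_gt0 => //; lra.
have te : t < e by rewrite gt_min; apply/orP; left; lra.
have tN : t * N < `|s| - l.
  have : t * (N + 1) <= `|s| - l.
    by rewrite -ler_pdivlMr ?ge_min ?lexx ?orbT//; lra.
  by rewrite mulrDr mulr1; lra.
have K : 2 * t * `|s| <= t ^+ 2 * N + 2 * l * t.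
  have [s0|s0] := leP 0 s.
    have := H t; rewrite (gtr0_norm t0) (ger0_norm s0); exact.
  have := H (- t); rewrite normrN (gtr0_norm t0) (ltr0_norm s0) sqrrN => /(_ te).
  by rewrite !mulrN !mulNr.
have : 0 < t * (`|s| - l - t * N) by rewrite mulr_gt0// subr_gt0.
have : 0 < t * (`|s| - l) by rewrite mulr_gt0.
by nra.
Qed.

Section norm2_theory.
Context (R : realType).

Lemma norm2_ge0 k (v : 'cV[R]_k) : 0 <= norm2 v.
Proof. exact: sqrtr_ge0. Qed.

Lemma sqr_norm2 k (v : 'cV[R]_k) : norm2 v ^+ 2 = \sum_i v i 0 ^+ 2.
Proof. by rewrite sqr_sqrtr// sumr_ge0// => i _; rewrite sqr_ge0. Qed.

Lemma sqr_norm2_mx k (v : 'cV[R]_k) : norm2 v ^+ 2 = (v^T *m v) 0 0.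
Proof. by rewrite sqr_norm2 mxE; apply: eq_bigr => i _; rewrite mxE expr2. Qed.

Lemma norm2_eq0 k (v : 'cV[R]_k) : norm2 v = 0 -> v = 0.
Proof.
move=> /(congr1 (fun x => x ^+ 2)); rewrite sqr_norm2 expr0n /= => /eqP.
rewrite psumr_eq0 => [/allP v0|i _]; last exact: sqr_ge0.
apply/matrixP => i j; rewrite mxE ord1; apply/eqP; rewrite -sqrf_eq0.
by have := v0 i; rewrite mem_index_enum => /(_ isT).
Qed.

Lemma sqr_norm2_subZ k (r z : 'cV[R]_k) (h : R) :
  norm2 (r - h *: z) ^+ 2
    = norm2 r ^+ 2 - 2 * h * (z^T *m r) 0 0 + h ^+ 2 * norm2 z ^+ 2.
Proof.
rewrite !sqr_norm2 mxE !mulr_sumr -sumrN -!big_split /=.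
by apply: eq_bigr => i _; rewrite !mxE; ring.
Qed.

Lemma norm2Z k (v : 'cV[R]_k) (h : R) : norm2 (h *: v) = `|h| * norm2 v.
Proof.
rewrite -sqrtr_sqr -sqrtrM ?sqr_ge0// mulr_sumr; congr Num.sqrt.
by apply: eq_bigr => i _; rewrite mxE exprMn.
Qed.

Lemma norm2_delta k (j : 'I_k) : norm2 (delta_mx j 0 : 'cV[R]_k) = 1.
Proof.
rewrite /norm2 (bigD1 j)//= mxE !eqxx expr1n big1 ?addr0 ?sqrtr1// => i ij.
by rewrite mxE (negbTE ij) expr0n.
Qed.

(** Cauchy-Schwarz against the indicator of [B], obtained by expanding the nonnegative double sum of
    the squared differences [(|v_i| - |v_j|)^2]. *)
Lemma ler_norm1_norm2 k (B : {set 'I_k}) (v : 'cV[R]_k) :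
  \sum_(i in B) `|v i 0| <= Num.sqrt #|B|%:R * norm2 v.
Proof.
rewrite -sqrtrM ?ler0n//; set s := \sum_(i in B) _.
have s0 : 0 <= s by apply: sumr_ge0.
apply: le_trans (_ : Num.sqrt (#|B|%:R * \sum_(i in B) `|v i 0| ^+ 2) <= _); last first.
  rewrite ler_wsqrtr// ler_wpM2l// big_mkcond/=; apply: ler_sum => i _.
  by case: ifP => _; rewrite ?real_normK ?num_real ?sqr_ge0.
rewrite -(ger0_norm s0) -sqrtr_sqr ler_wsqrtr//.
have : 0 <= \sum_(i in B) \sum_(j in B) (`|v i 0| - `|v j 0|) ^+ 2.
  by apply: sumr_ge0 => i _; apply: sumr_ge0 => j _; exact: sqr_ge0.
set q := \sum_(i in B) `|v i 0| ^+ 2.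
have -> : \sum_(i in B) \sum_(j in B) (`|v i 0| - `|v j 0|) ^+ 2 =
    2 * (#|B|%:R * q - s ^+ 2).
  transitivity (\sum_(i in B) (#|B|%:R * `|v i 0| ^+ 2 - 2 * `|v i 0| * s + q)).
    apply: eq_bigr => i _.
    rewrite -[#|B|%:R]sumr_const mulr_suml mulr_sumr -sumrN -!big_split/=.
    by apply: eq_bigr => j _; ring.
  rewrite !big_split/= sumrN -mulr_sumr -mulr_suml -mulr_sumr sumr_const -/s -/q.
  by rewrite -mulr_natl; ring.
by rewrite pmulr_rge0 ?subr_ge0.
Qed.

End norm2_theory.

(** * Smallest eigenvalue and Rayleigh quotient *)

Section lambda_min_theory.
Context (R : realType).

Lemma continuous_sum_fun (T : topologicalType) (I : finType) (f : I -> T -> R) :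
  (forall i, continuous (f i)) -> continuous (fun x => \sum_i f i x).
Proof.
move=> cf x; apply: cvg_big => [|i _]; last exact: cf.
by apply: add_continuous.
Qed.

(* The minimum of the Rayleigh quotient over the (compact) unit sphere is
   attained, and a minimizer is an eigenvector. *)
Lemma lambda_min_le k (A : 'M[R]_k) (v : 'rV[R]_k) : A^T = A ->
  lambda_min A * (v *m v^T) 0 0 <= (v *m A *m v^T) 0 0.
Proof.
move=> sA.
pose dot (u w : 'rV[R]_k) := (u *m w^T) 0 0.
have dotE u w : dot u w = \sum_i u 0 i * w 0 i.
  by rewrite /dot mxE; apply: eq_bigr => i _; rewrite mxE.
have dotZl h u w : dot (h *: u) w = h * dot u w by rewrite /dot -scalemxAl mxE.
have dotZr h u w : dot u (h *: w) = h * dot u w.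
  by rewrite /dot linearZ/= -scalemxAr mxE.
have dotDl u1 u2 w : dot (u1 + u2) w = dot u1 w + dot u2 w.
  by rewrite /dot mulmxDl mxE.
have dotDr u w1 w2 : dot u (w1 + w2) = dot u w1 + dot u w2.
  by rewrite /dot linearD/= mulmxDr mxE.
have dotC u w : dot u w = dot w u.
  by rewrite !dotE; apply: eq_bigr => i _; rewrite mulrC.
have dotA u w : dot (u *m A) w = dot (w *m A) u.
  by rewrite [RHS]dotC /dot trmx_mul sA mulmxA.
have dot_ge0 u : 0 <= dot u u.
  by rewrite dotE; apply: sumr_ge0 => i _; rewrite -expr2 sqr_ge0.
have dot_eq0 u : dot u u = 0 -> u = 0.
  rewrite dotE => /eqP; rewrite psumr_eq0 => [/allP u0|i _]; last first.
    by rewrite -expr2 sqr_ge0.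
  apply/matrixP => i j; rewrite mxE ord1; apply/eqP; rewrite -sqrf_eq0 expr2.
  by have := u0 j; rewrite mem_index_enum => /(_ isT).
(* Setting [v = 0] aside also disposes of [k = 0], where the unit sphere is empty. *)
have [->|v0] := eqVneq v 0; first by rewrite !mul0mx mxE mulr0.
have normalize u : u != 0 -> dot ((Num.sqrt (dot u u))^-1 *: u)
    ((Num.sqrt (dot u u))^-1 *: u) = 1.
  move=> u0; have uu0 : 0 < dot u u.
    by rewrite lt_def dot_ge0 andbT; apply: contra u0 => /eqP/dot_eq0 ->.
  by rewrite dotZl dotZr mulrA -invfM -expr2 sqr_sqrtr ?ltW// mulVf ?gt_eqF.
pose S := [set u : 'rV[R]_k | dot u u = 1].
have coord i : continuous (fun u : 'rV[R]_k => u 0 i) by exact: coord_continuous.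
have cS : compact S.
  apply: bounded_closed_compact.
    exists 1; split => // M M1 u /= uS.
    (* The ambient norm is the largest absolute entry, which is at most 1 when the squares of the
       entries sum to 1. *)
    rewrite [leLHS]/Num.norm/= mx_normrE; apply: bigmax_le; first lra.
    move=> [i j] _ /=; rewrite ord1; apply: le_trans (ltW M1).
    rewrite -(ler_pXn2r (n := 2)) ?nnegrE// expr1n real_normK ?num_real//.
    rewrite -uS dotE (bigD1 j)//= expr2 lerDl.
    by apply: sumr_ge0 => l _; rewrite -expr2 sqr_ge0.
  rewrite (_ : S = (fun u => dot u u) @^-1` [set 1]); last by apply/seteqP; split.
  apply: preimage_closed; last exact: closed_eq.
  move=> u _; under eq_fun do rewrite dotE.
  apply: continuous_sum_fun => i {}u.
  by apply: continuousM; apply: coord.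
have S0 : S !=set0 by exists ((Num.sqrt (dot v v))^-1 *: v); exact: normalize.
have [|c cinS cmin] := @EVT_min_rV R k (fun u => dot (u *m A) u) S S0 cS.
  apply: continuous_subspaceT => u.
  under eq_fun do rewrite dotE.
  apply: continuous_sum_fun => i {}u.
  apply: (@continuousM _ _ (fun u : 'rV[R]_k => (u *m A) 0 i)); last exact: coord.
  rewrite (_ : (fun _ => _) = fun u : 'rV[R]_k => \sum_j u 0 j * A j i); last first.
    by apply/funext => w; rewrite mxE.
  apply: continuous_sum_fun => j {}u.
  by apply: continuousM; [exact: coord|exact: cst_continuous].
have cS1 : dot c c = 1 by move: cinS; rewrite inE.
set mu := dot (c *m A) c in cmin.
have mu_le u : mu * dot u u <= dot (u *m A) u.
  have [->|u0] := eqVneq u 0.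
    by rewrite mul0mx /dot mul0mx mxE mulr0.
  have uu0 : 0 < dot u u.
    by rewrite lt_def dot_ge0 andbT; apply: contra u0 => /eqP/dot_eq0 ->.
  have := cmin ((Num.sqrt (dot u u))^-1 *: u).
  rewrite inE => /(_ (normalize _ u0)).
  rewrite -scalemxAl dotZl dotZr mulrA -invfM -expr2 (sqr_sqrtr (dot_ge0 u)).
  by rewrite [leRHS]mulrC ler_pdivlMr.
have eigen : c *m A = mu *: c.
  (* Expanding [mu_le] at [c + h *: w], the constant terms cancel since [dot c c = 1]; what remains
     is quadratic in [h], so its linear coefficient vanishes. Taking [w = c *m A - mu *: c] then
     gives the eigenvector equation. *)
  have lin w : dot (c *m A) w - mu * dot c w = 0.
    apply/eqP; rewrite -normr_le0 -normrN.
    apply: (@ler_norm_quadratic _ _ (dot (w *m A) w - mu * dot w w) 0 1) => //.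
      by rewrite subr_ge0.
    move=> h _; rewrite mulr0 mul0r addr0 -subr_ge0.
    have := mu_le (c + h *: w).
    rewrite mulmxDl -scalemxAl !(dotDl, dotDr, dotZl, dotZr) (dotA w c) (dotC w c).
    rewrite cS1 -/mu -subr_ge0; congr (0 <= _); ring.
  apply/eqP; rewrite -subr_eq0; apply/eqP/dot_eq0.
  set w := c *m A - mu *: c; rewrite -[RHS](lin w) -mulNr -dotZl -dotDl.
  by rewrite scaleNr.
have c0 : c != 0.
  by apply: contra_eq_neq cS1 => ->; rewrite /dot mul0mx mxE eq_sym oner_neq0.
have -> : (v *m A *m v^T) 0 0 = dot (v *m A) v by [].
apply: le_trans (mu_le v); rewrite ler_wpM2r ?dot_ge0//.
(* [mu] is an eigenvalue, and by [mu_le] it is also a lower bound of all eigenvalues, which is what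
   makes [inf] a genuine lower bound. *)
apply: ge_inf; last by apply/eigenvalueP; exists c.
exists mu => x /eigenvalueP[w wx w0].
have ww0 : 0 < dot w w.
  by rewrite lt_def dot_ge0 andbT; apply: contra w0 => /eqP/dot_eq0 ->.
by have := mu_le w; rewrite wx dotZl ler_pM2r.
Qed.

End lambda_min_theory.

(** * Lipschitz bound for the SCAD and MCP penalties *)

Section penalty_theory.
Context (R : realType) (k : penalty) (a l : R).
Hypotheses (ha : admissible k a) (l0 : 0 < l).

Lemma pos_part_max (x : R) : pos_part x = Num.max x 0.
Proof.
by rewrite /pos_part; case: ltP => x0; rewrite ?mulr1 ?mulr0//.
Qed.

(** The upper bound comes from [(a l - t)_+ <= (a - 1) l] for SCAD, where [t > l], and from
    [(a l - t)_+ <= a l] for MCP. *)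
Lemma pen_deriv_ge0_le (t : R) : 0 <= t -> 0 <= pen_deriv k a l t <= l.
Proof.
move=> t0; case: k ha => /= [a2|a1]; rewrite pos_part_max.
  have al0 : 0 < (a - 1) * l by rewrite mulr_gt0//; lra.
  have M0 : 0 <= Num.max (a * l - t) 0 by rewrite le_max lexx orbT.
  case: (leP t l) => tl; rewrite ?mulr0 ?mulr1 ?addr0 ?add0r ?mulr1.
    by rewrite ltW//=.
  rewrite mulr_ge0 ?divr_ge0 ?(ltW l0) ?(ltW al0)//=.
  rewrite ger_pMr// ler_pdivrMr// mul1r ge_max (ltW al0) andbT; lra.
have a0 : 0 < a by lra.
rewrite mulr_ge0 ?invr_ge0 ?(ltW a0) ?le_max ?lexx ?orbT//=.
rewrite ler_pdivrMl// ge_max; apply/andP; split; first lra.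
by rewrite mulr_ge0// ltW.
Qed.

Lemma measurable_pen_deriv : measurable_fun setT (pen_deriv k a l).
Proof.
have mp : measurable_fun setT (fun t : R => pos_part (a * l - t)).
  under eq_fun do rewrite pos_part_max.
  apply: measurable_maxr => //; exact: measurable_funB.
case: k => /=; last exact: measurable_funM.
apply: measurable_funM => //; apply: measurable_funD.
  rewrite (_ : (fun _ => _) = \1_(`]-oo, l]%classic)).
    exact: measurable_indic.
  by apply/funext => t; rewrite indicE mem_setE in_itv.
apply: measurable_funM; first exact: measurable_funM.
rewrite (_ : (fun _ => _) = \1_(`]l, +oo[%classic)).
  exact: measurable_indic.
by apply/funext => t; rewrite indicE mem_setE in_itv/= andbT.
Qed.

Lemma pen_lipschitz (s t : R) : 0 <= s -> s <= t ->
  `|pen k a l t - pen k a l s| <= l * (t - s).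
Proof.
move=> s0 st.
have mf D : measurable D -> measurable_fun D (pen_deriv k a l).
  by move=> mD; exact: measurable_funS measurable_pen_deriv.
(* The boolean selects the left endpoint: closed for [[0, t]], which defines the penalty, and open
   for []s, t]], over which the difference of two penalties is an integral. *)
have ip (b : bool) u : 0 <= u -> u <= t -> (@lebesgue_measure R).-integrable
    [set` Interval (BSide b u) (BRight t)] (EFin \o pen_deriv k a l).
  move=> u0 ut; apply: measurable_bounded_integrable => //; last 2 first.
  - exact: mf.
  - exists l; split; first exact: num_real.
    move=> M lM x /= xut; apply: le_trans (ltW lM).
    have x0 : 0 <= x.
      by move: xut; rewrite in_itv/= => /andP[+ _]; case: b => /=; lra.
    by have /andP[f0 fl] := pen_deriv_ge0_le x0; rewrite ger0_norm.
  rewrite [X in (X < _)%E]lebesgue_measure_itv/=.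
  by case: ifP => _; rewrite -?EFinB ltry.
have ist := ip false _ s0 st.
rewrite /pen Rintegral_itvB ?bnd_simp//; last first.
  exact: (ip true _ (lexx 0) (le_trans s0 st)).
have x0 x : `]s, t]%classic x -> 0 <= x.
  by rewrite /= in_itv/= => /andP[/ltW sx _]; exact: le_trans s0 sx.
rewrite ger0_norm; last first.
  by apply: Rintegral_ge0 => x /x0 /pen_deriv_ge0_le /andP[].
have -> : l * (t - s) = \int[@lebesgue_measure R]_(x in `]s, t]) l.
  rewrite Rintegral_cst// [X in fine X]lebesgue_measure_itv/= lte_fin.
  case: ltP => // ts.
  by rewrite (le_anti (introT andP (conj st ts))) subrr.
apply: le_Rintegral => //; last by move=> x /x0 /pen_deriv_ge0_le /andP[].
apply: (measurable_bounded_integrable (f := fun=> l)) => //.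
  rewrite [X in (X < _)%E]lebesgue_measure_itv/=.
  by case: ifP => _; rewrite -?EFinB ltry.
by exists `|l|; split; [exact: num_real|move=> M /ltW lM x _ /=].
Qed.

Lemma pen_norm_lipschitz (x h : R) :
  `|pen k a l `|x + h| - pen k a l `|x| | <= l * `|h|.
Proof.
apply: le_trans (_ : l * `| `|x + h| - `|x| | <= _); last first.
  by rewrite ler_pM2l//; apply: le_trans (ler_dist_dist _ _) _; rewrite addrC addKr.
have [xh|/ltW xh] := leP `|x| `|x + h|.
  rewrite [X in _ <= _ * X]ger0_norm ?subr_ge0//.
  exact: pen_lipschitz.
rewrite distrC [X in _ <= _ * X]distrC [X in _ <= _ * X]ger0_norm ?subr_ge0//.
exact: pen_lipschitz.
Qed.

End penalty_theory.

(** * Gram matrices and restricted eigenvalues *)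

Section gram_theory.
Context (R : realType) (n p : nat) (X : 'M[R]_(n, p)).

Lemma cols_in_mul (B : {set 'I_p}) (b : 'cV[R]_p) :
  (forall j, j \notin B -> b j 0 = 0) -> X *m b = cols_in X B *m rows_in b B.
Proof.
move=> b0; apply/matrixP => i l; rewrite !mxE ord1.
rewrite (bigID (mem B))/= [X in _ + X]big1 ?addr0; last first.
  by move=> j /b0 ->; rewrite mulr0.
by rewrite [LHS]big_enum_val; apply: eq_bigr => j _; rewrite !mxE.
Qed.

Lemma norm2_rows_in (B : {set 'I_p}) (b : 'cV[R]_p) :
  (forall j, j \notin B -> b j 0 = 0) -> norm2 (rows_in b B) = norm2 b.
Proof.
move=> b0; congr Num.sqrt; rewrite [RHS](bigID (mem B))/= [X in _ + X]big1 ?addr0.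
  by rewrite [RHS]big_enum_val; apply: eq_bigr => j _; rewrite !mxE.
by move=> j /b0 ->; rewrite expr0n.
Qed.

Lemma trmx_gram (B : {set 'I_p}) : (gram X B)^T = gram X B.
Proof. by rewrite /gram linearZ/= trmx_mul trmxK. Qed.

Lemma gram_quad (B : {set 'I_p}) (v : 'cV[R]_#|B|) :
  (v^T *m gram X B *m v) 0 0 = n%:R^-1 * norm2 (cols_in X B *m v) ^+ 2.
Proof.
by rewrite sqr_norm2_mx trmx_mul /gram -scalemxAr -scalemxAl mxE !mulmxA.
Qed.

Lemma lambda_min_gram_le (B : {set 'I_p}) (v : 'cV[R]_#|B|) :
  lambda_min (gram X B) * norm2 v ^+ 2 <= n%:R^-1 * norm2 (cols_in X B *m v) ^+ 2.
Proof.
rewrite -gram_quad sqr_norm2_mx.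
by have := lambda_min_le v^T (trmx_gram B); rewrite trmxK.
Qed.

(** It bounds from below the set whose infimum is [xi_min], so that this infimum lies below each of
    its members. *)
Lemma lambda_min_gram_ge0 (B : {set 'I_p}) : 0 <= lambda_min (gram X B).
Proof.
rewrite /lambda_min; set E := [set x | _].
(* With [B] empty there is no eigenvalue, and the infimum of the empty set is 0. *)
have [->|/set0P E0] := eqVneq E set0; first by rewrite inf0.
apply: lb_le_inf => // x /eigenvalueP[w wx w0].
have w20 : 0 < norm2 w^T ^+ 2.
  rewrite exprn_gt0// lt_def norm2_ge0 andbT; apply: contra w0 => /eqP/norm2_eq0 w0.
  by rewrite -[w]trmxK w0 trmx0.
rewrite -(pmulr_lge0 _ w20) sqr_norm2_mx trmxK.
have := gram_quad w^T; rewrite trmxK wx -scalemxAl mxE => ->.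
by rewrite mulr_ge0 ?invr_ge0 ?ler0n ?sqr_ge0.
Qed.

Lemma xi_min_le (A B : {set 'I_p}) (m : nat) :
  (#|B| <= m)%N -> A \subset B -> xi_min X A m <= lambda_min (gram X B).
Proof.
move=> Bm AB; apply: ge_inf; last by exists B.
by exists 0 => _ [C _ <-]; exact: lambda_min_gram_ge0.
Qed.

(** A kernel vector makes the quadratic form vanish, hence has norm 0 by [lambda_min_gram_le]. *)
Lemma gram_unitmx (B : {set 'I_p}) : 0 < lambda_min (gram X B) ->
  (cols_in X B)^T *m cols_in X B \in unitmx.
Proof.
move=> l0; rewrite -row_free_unit; apply: inj_row_free => v vG.
have := lambda_min_gram_le v^T; rewrite [X in _ <= _ * X]sqr_norm2_mx.
rewrite trmx_mul trmxK -!mulmxA (mulmxA v) (mulmxA (v *m _)) -(mulmxA v) vG.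
rewrite mul0mx mxE mulr0 pmulr_rle0// => v0.
have /eqP : norm2 v^T ^+ 2 = 0 by apply/le_anti; rewrite v0 sqr_ge0.
by rewrite sqrf_eq0 => /eqP/norm2_eq0 {}v0; rewrite -[v]trmxK v0 trmx0.
Qed.

End gram_theory.

(** * Stationarity of least squares and of local minima *)

(** The normal equations, by perturbing [g] along each axis and using [ler_norm_quadratic] with
    [l = 0]. *)
Lemma least_squares_orthogonal (R : realType) (n k : nat) (Z : 'M[R]_(n, k))
    (y : 'cV[R]_n) (g : 'cV[R]_k) :
  least_squares Z y g -> Z^T *m (y - Z *m g) = 0.
Proof.
move=> lsg; apply/matrixP => j l; rewrite ord1 [RHS]mxE.
set r := y - Z *m g.
have -> : (Z^T *m r) j 0 = ((col j Z)^T *m r) 0 0.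
  by rewrite tr_col -row_mul [RHS]mxE.
apply/eqP; rewrite -normr_le0.
apply: (ler_norm_quadratic (sqr_ge0 (norm2 (col j Z))) ltr01) => h _.
rewrite mulr0 mul0r addr0.
have : norm2 r ^+ 2 <= norm2 (r - h *: col j Z) ^+ 2.
  rewrite ler_pXn2r ?nnegrE ?norm2_ge0//.
  have := lsg (g + h *: delta_mx j 0).
  by rewrite mulmxDr -scalemxAr -colE opprD addrA.
by rewrite sqr_norm2_subZ; lra.
Qed.

(* A differentiability-free form of the stationarity conditions: the penalty
   being Lipschitz is all that is used. *)
Lemma local_minimum_gradient (R : realType) (k : penalty) (a l : R) (n p : nat)
    (X : 'M[R]_(n, p)) (y : 'cV[R]_n) (b : 'cV[R]_p) (j : 'I_p) :
  admissible k a -> 0 < l -> (0 < n)%N ->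
  ((col j X)^T *m col j X) 0 0 / n%:R = 1 ->
  local_minimum (objective k a l X y) b ->
  `|((col j X)^T *m (y - X *m b)) 0 0| <= n%:R * l.
Proof.
move=> ha l0 n0 Xj [e e0 bmin]; set r := y - X *m b; set g := (_ *m r) 0 0.
have nR0 : 0 < n%:R :> R by rewrite ltr0n.
rewrite mulrC -ler_pdivrMr// -[X in `|g| / X]gtr0_norm// -normf_div.
(* After division by [n], the normalization of the columns makes the quadratic coefficient equal to
   1. *)
apply: (ler_norm_quadratic ler01 e0) => h he.
have : objective k a l X y b <= objective k a l X y (b + h *: delta_mx j 0).
  by apply: bmin; rewrite addrC addKr norm2Z norm2_delta mulr1.
rewrite /objective mulmxDr -scalemxAr -colE opprD addrA -/r.
rewrite sqr_norm2_subZ -/g [norm2 (col j X) ^+ 2]sqr_norm2_mx.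
rewrite [X in _ + X <= _](bigD1 j)// [X in _ <= _ + X](bigD1 j)//=.
have -> : \sum_(i | i != j) pen k a l `|(b + h *: delta_mx j 0) i 0|
    = \sum_(i | i != j) pen k a l `|b i 0|.
  by apply: eq_bigr => i /negbTE ij; rewrite !mxE ij mulr0 addr0.
have -> : (b + h *: delta_mx j 0) j 0 = b j 0 + h by rewrite !mxE !eqxx mulr1.
have -> : ((col j X)^T *m col j X) 0 0 = n%:R.
  by rewrite -[LHS](divfK (lt0r_neq0 nR0)) Xj mul1r.
have -> : (2 * n%:R)^-1 * (norm2 r ^+ 2 - 2 * h * g + h ^+ 2 * n%:R)
    = (2 * n%:R)^-1 * norm2 r ^+ 2 - h * (g / n%:R) + h ^+ 2 / 2.
  by field; rewrite gt_eqF.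
have := pen_norm_lipschitz ha l0 (b j 0) h; rewrite ler_norml => /andP[_].
lra.
Qed.

(** * Oracle residual as projected noise *)

Section oracle_residual.
Context (R : realType) (n k : nat) (Z : 'M[R]_(n, k)).
Hypothesis Zu : Z^T *m Z \in unitmx.

(** The orthogonal projection onto the complement of the column span of [Z]. *)
Definition residual_mx : 'M[R]_n := 1%:M - Z *m invmx (Z^T *m Z) *m Z^T.

Lemma trmx_residual_mx : residual_mx^T = residual_mx.
Proof.
by rewrite /residual_mx linearB/= trmx1 !trmx_mul trmxK trmx_inv trmx_mul trmxK mulmxA.
Qed.

Lemma residual_mx_mul : residual_mx *m Z = 0.
Proof. by rewrite mulmxBl mul1mx -!mulmxA mulVmx// mulmx1 subrr. Qed.

(** Pythagoras: [x] splits into its projection [z] and a vector [w] of the column span, orthogonal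
    to [z]. *)
Lemma norm2_residual_mx_le (x : 'cV[R]_n) : norm2 (residual_mx *m x) <= norm2 x.
Proof.
rewrite -(ler_pXn2r (n := 2)) ?nnegrE ?norm2_ge0//.
set z := residual_mx *m x.
have xE : x = z + Z *m (invmx (Z^T *m Z) *m (Z^T *m x)).
  by rewrite /z /residual_mx mulmxBl mul1mx !mulmxA subrK.
set w := Z *m _ in xE.
have wz : w^T *m z = 0.
  rewrite trmx_mul /z -mulmxA (mulmxA Z^T).
  have -> : Z^T *m residual_mx = 0.
    by rewrite -trmx_residual_mx -trmx_mul residual_mx_mul trmx0.
  by rewrite mul0mx mulmx0.
have -> : x = z - (-1) *: w by rewrite scaleN1r opprK.
rewrite sqr_norm2_subZ wz mxE mulr0 subr0 lerDl.
by rewrite mulr_ge0 ?sqr_ge0.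
Qed.

(** The projection fixes the residual, by the normal equations, and kills both [Z *m g0] and
    [Z *m g], leaving only the noise. *)
Lemma least_squares_residual (g0 g : 'cV[R]_k) (e : 'cV[R]_n) :
  least_squares Z (Z *m g0 + e) g -> Z *m g0 + e - Z *m g = residual_mx *m e.
Proof.
move=> /least_squares_orthogonal; set r := _ - _ => Zr.
have : residual_mx *m r = r.
  by rewrite mulmxBl mul1mx -!mulmxA Zr !mulmx0 subr0.
by move=> <-; rewrite /r mulmxBr mulmxDr !mulmxA residual_mx_mul !mul0mx add0r subr0.
Qed.

End oracle_residual.

(** * Deterministic error bound *)

(** The two vectors enter symmetrically, through their supports and their stationarity bounds; the
    factor 2 is the sum of these two bounds. *)
Lemma sparse_error_bound (R : realType) (n p m : nat) (X : 'M[R]_(n, p))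
    (A B : {set 'I_p}) (y : 'cV[R]_n) (b1 b2 : 'cV[R]_p) (l : R) :
  (0 < n)%N -> 0 <= l -> A \subset B -> (#|B| <= m)%N -> 0 < xi_min X A m ->
  (forall j, j \notin B -> b1 j 0 = 0) -> (forall j, j \notin B -> b2 j 0 = 0) ->
  (forall j, `|((col j X)^T *m (y - X *m b1)) 0 0| <= n%:R * l) ->
  (forall j, `|((col j X)^T *m (y - X *m b2)) 0 0| <= n%:R * l) ->
  norm2 (b1 - b2) <= 2 * l * Num.sqrt m%:R * (xi_min X A m)^-1.
Proof.
move=> n0 l0 AB Bm xi0 b1B b2B g1 g2.
have nR0 : 0 < n%:R :> R by rewrite ltr0n.
pose dl := b1 - b2.
have dB j : j \notin B -> dl j 0 = 0.
  by move=> jB; rewrite !mxE b1B// b2B// subrr.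
have lower : xi_min X A m * norm2 dl ^+ 2 <= n%:R^-1 * norm2 (X *m dl) ^+ 2.
  rewrite (cols_in_mul X dB) -(norm2_rows_in dB).
  apply: le_trans (lambda_min_gram_le _ _).
  by rewrite ler_wpM2r ?sqr_ge0// xi_min_le.
have upper : n%:R^-1 * norm2 (X *m dl) ^+ 2 <= 2 * l * (Num.sqrt m%:R * norm2 dl).
  (* [X *m dl] is the difference of the two residuals, and pairing it with [X *m dl] only involves
     the columns in [B]. *)
  have -> : norm2 (X *m dl) ^+ 2 = \sum_(j in B) dl j 0 *
      (((col j X)^T *m (y - X *m b2)) 0 0 - ((col j X)^T *m (y - X *m b1)) 0 0).
    rewrite sqr_norm2_mx trmx_mul -mulmxA mxE (bigID (mem B))/=.
    rewrite [X in _ + X]big1 ?addr0 => [|j /dB dj]; last by rewrite mxE dj mul0r.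
    apply: eq_bigr => j _; rewrite mxE; congr (_ * _).
    have -> : X *m dl = (y - X *m b2) - (y - X *m b1).
      by rewrite mulmxBr opprB [RHS]addrC addrA subrK.
    rewrite mulmxBr mxE [X in _ + X]mxE; congr (_ - _).
      by rewrite tr_col -row_mul [RHS]mxE.
    by rewrite tr_col -row_mul [RHS]mxE.
  rewrite mulrC ler_pdivrMr//.
  apply: le_trans (_ : \sum_(j in B) `|dl j 0| * (2 * (n%:R * l)) <= _).
    apply: ler_sum => j _; apply: le_trans (ler_norm _) _.
    rewrite normrM ler_wpM2l//; apply: le_trans (ler_normB _ _) _.
    by rewrite mulr_natl mulr2n lerD.
  rewrite -mulr_suml mulrC.
  have -> : 2 * l * (Num.sqrt m%:R * norm2 dl) * n%:R
      = 2 * (n%:R * l) * (Num.sqrt m%:R * norm2 dl) by ring.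
  apply: ler_wpM2l; first by rewrite !mulr_ge0.
  apply: le_trans (ler_norm1_norm2 _ _) _.
  by rewrite ler_wpM2r ?norm2_ge0// ler_wsqrtr// ler_nat.
rewrite -/dl ler_pdivlMr//.
have [->|d0] := eqVneq (norm2 dl) 0.
  by rewrite mul0r !mulr_ge0 ?sqrtr_ge0.
have dp : 0 < norm2 dl by rewrite lt_def d0 norm2_ge0.
rewrite -(ler_pM2r dp).
apply: le_trans (_ : n%:R^-1 * norm2 (X *m dl) ^+ 2 <= _).
  by apply: le_trans lower; rewrite mulrAC -expr2 mulrC.
by apply: le_trans upper _; rewrite mulrA.
Qed.

(** * Probability bound for all sparse local minima *)

(** The event ranges over all sparse local minima at once, so it covers any choice of one,
    measurable in the sample or not; its own measurability is not clear, hence [prob_ge]. *)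
Theorem theorem5p2 (R : realType) (k : penalty) (a sigma C1 cstar : R)
    (d : nat -> measure_display) (T : forall n, measurableType (d n))
    (P : forall n, probability (T n) R)
    (p : nat -> nat) (X : forall n, 'M[R]_(n, p n))
    (beta : forall n, 'cV[R]_(p n))
    (eps : forall n, 'I_n -> {RV (P n) >-> R})
    (lambda u : nat -> R) (m : nat -> nat)
    (betao : forall n, T n -> 'cV[R]_(p n)) :
  let y n (w : T n) := response (X n) (beta n) (fun i => eps n i w) in
  let A0 n := supp (beta n) in
  let q n : R := #|A0 n|%:R in
  let dstar n := min_signal (beta n) in
  admissible k a -> 0 < sigma -> 0 < C1 -> 0 < cstar ->
  (forall n, 0 < lambda n) ->
  (forall n, 0 < u n) ->
  (\forall n \near \oo, forall j, ((col j (X n))^T *m col j (X n)) 0 0 / n%:R = 1) ->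
  (forall n w, oracle_estimator (X n) (y n w) (A0 n) (betao n w)) ->
  (\forall n \near \oo, C1 <= lambda_min (gram (X n) (A0 n))) ->
  (forall n, iid_subgaussian (eps n) sigma) ->
  (\forall n \near \oo, (m n)%:R = q n * (u n + 1)) ->
  (\forall n \near \oo, relaxed_SRC (X n) (A0 n) (m n) cstar) ->
  lambda =o_\oo dstar ->
  \forall n \near \oo,
    prob_ge (P n)
      [set w | forall b : 'cV[R]_(p n),
         local_minimum (objective k a (lambda n) (X n) (y n w)) b ->
         (norm0 b)%:R <= q n * u n ->
         norm2 (b - betao n w) <=
           2 * lambda n * Num.sqrt (q n * (u n + 1)) * (xi_min (X n) (A0 n) (m n))^-1]
      (1 - 2 * q n * expR (- (C1 * n%:R * (dstar n - a * lambda n) ^+ 2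
                              / (2 * sigma ^+ 2)))
         - 2 * ((p n)%:R - q n) * expR (- (n%:R * lambda n ^+ 2 / (2 * sigma ^+ 2)))).
Proof.
move=> y A0 q dstar ha s0 C0 c0 l0 u0 hX horc hlam hiid hm hsrc _.
near=> n.
have hXn : forall j, ((col j (X n))^T *m col j (X n)) 0 0 / n%:R = 1 by near: n.
have hlamn : C1 <= lambda_min (gram (X n) (A0 n)) by near: n.
have hmn : (m n)%:R = q n * (u n + 1) by near: n.
have [m0 _ mn hxi] : relaxed_SRC (X n) (A0 n) (m n) cstar by near: n.
have n0 : (0 < n)%N by exact: leq_trans m0 mn.
have nR0 : 0 < n%:R :> R by rewrite ltr0n.
pose Z := cols_in (X n) (A0 n).
have Zu : Z^T *m Z \in unitmx by apply: gram_unitmx; exact: lt_le_trans hlamn.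
(* As the projection is symmetric, pairing column [j] with the projected noise is pairing [v j] with
   the noise itself. *)
pose v j i := (residual_mx Z *m col j (X n)) i 0.
pose J := (~: A0 n)%SET.
pose E := [set w | forall j, j \in J ->
  `|\sum_i v j i * eps n i w| <= n%:R * lambda n].
have vN j : j \in J -> \sum_i v j i ^+ 2 <= n%:R.
  move=> _; rewrite -sqr_norm2.
  have -> : n%:R = norm2 (col j (X n)) ^+ 2.
    by rewrite sqr_norm2_mx -[RHS](divfK (lt0r_neq0 nR0)) hXn mul1r.
  by rewrite ler_pXn2r ?nnegrE ?norm2_ge0// norm2_residual_mx_le.
have nl0 : 0 < n%:R * lambda n by rewrite mulr_gt0.
exists E; [split|].
- exact: measurable_max_lin.
- move=> w Ew b bmin bu.
  have [ls bo0] := horc n w.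
  pose B := (A0 n :|: supp b)%SET.
  have outB (c : 'cV[R]_(p n)) :
      supp c \subset B -> forall j, j \notin B -> c j 0 = 0.
    move=> /fintype.subsetP cB j; apply: contraNeq => cj.
    by apply: cB; rewrite inE.
  rewrite -hmn; apply: (@sparse_error_bound _ _ _ _ _ (A0 n) B (y n w)) => //.
  + exact: ltW.
  + exact: finset.subsetUl.
  (* The union has at most [q + q u = q (u + 1) = m] elements. *)
  + rewrite -(ler_nat R) hmn mulrDr mulr1 addrC.
    apply: le_trans (_ : (#|A0 n| + #|supp b|)%:R <= _); last by rewrite natrD lerD2l.
    by rewrite ler_nat cardsU leq_subr.
  + exact: lt_le_trans hxi.
  + by apply: outB; exact: finset.subsetUr.
  + by move=> j; rewrite inE negb_or => /andP[/bo0].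
  + by move=> j; exact: local_minimum_gradient bmin.
  have ZB : X n *m betao n w = Z *m rows_in (betao n w) (A0 n).
    exact: cols_in_mul.
  have Zbeta : X n *m beta n = Z *m rows_in (beta n) (A0 n).
    by apply: cols_in_mul => j; rewrite inE negbK => /eqP.
  (* Stationarity of the oracle: on [A0] the inner product is 0 by the normal equations, and off
     [A0] it is controlled by the event [E]. *)
  move=> j; have [jA|jA] := boolP (j \in A0 n).
    have -> : col j (X n) = col (enum_rank_in jA j) Z.
      by apply/matrixP => i l; rewrite !mxE enum_rankK_in.
    rewrite tr_col -row_mul ZB (least_squares_orthogonal ls) !mxE normr0.
    exact: ltW.
  have -> : y n w - X n *m betao n w = residual_mx Z *m \col_i eps n i w.
    rewrite ZB; move: ls; rewrite /y /response Zbeta; exact: least_squares_residual.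
  have := Ew j; rewrite inE => /(_ jA); congr (`|_| <= _).
  rewrite mulmxA -trmx_residual_mx -trmx_mul mxE.
  by apply: eq_bigr => i _; rewrite [X in _ = X * _]mxE [X in _ = _ * X]mxE.
(* With [N = n] and [t = n * lambda], the probability of [E] is at least 1 minus the second
   exponential term; subtracting the first, which is nonnegative, only lowers the bound. *)
apply: le_trans (subgaussian_max_tail s0 (hiid n) nR0 vN nl0).
rewrite lee_fin.
have -> : (n%:R * lambda n) ^+ 2 / (2 * sigma ^+ 2 * n%:R)
    = n%:R * lambda n ^+ 2 / (2 * sigma ^+ 2).
  by field; rewrite !lt0r_neq0.
have -> : #|J|%:R = (p n)%:R - q n.
  by rewrite -[X in X%:R - _]card_ord -(cardsC (A0 n)) natrD addrC addKr.
rewrite lerD2r gerBl// !mulr_ge0 ?expR_ge0// ler0n.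
Unshelve. all: by end_near. Qed.
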